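(* Let $N\ge 0$ be an integer and let $\Omega(k)=\sum_{j=0}^N \eta_j k^{2j+1}$ be an odd polynomial of degree $2N+1$ with coefficients $\eta_j\in\mathbb{C}$, $j=0,\dots,N$. Let $\triangle n$ be a positive integer, let $\mu\in\mathbb{R}$, and set $$\gamma := \frac{\mu(\triangle n+\mu)}{(\triangle n)^2}.$$ Then $$\Omega(\triangle n+\mu)-\Omega(\mu)=\sum_{j=0}^{N}\eta_j\,(\triangle n)^{2j+1}\,s_{2j+1}(\gamma),$$ where $s_{2j+1}=s_{2j+1}(\gamma)$ is the polynomial of degree $j$ in $\gamma$ defined by the recurrence $s_0=2$, $s_1=1$, $s_{m+1}(\gamma)=s_m(\gamma)+\gamma s_{m-1}(\gamma)$ for $m\ge 1$.
   Context: $\triangle n$ is a single symbol denoting a positive integer (a difference of two Fourier indices). *)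

(* Defs.v *)
From mathcomp Require Import all_boot all_order all_algebra.
From mathcomp Require Import reals complex.

Set Implicit Arguments.
Unset Strict Implicit.
Unset Printing Implicit Defensive.

Import Order.TTheory GRing.Theory Num.Theory.
Local Open Scope ring_scope.

Definition odd_polynomial (K : nzRingType) (N : nat) (eta : 'I_N.+1 -> K) :
    {poly K} :=
  \sum_(j < N.+1) eta j *: 'X^(2 * j + 1).

(* The recurrence s_(m+1) = s_m + gamma s_(m-1), with 'X in the role of gamma. *)
Fixpoint s_poly (K : nzRingType) (m : nat) : {poly K} :=
  match m with
  | 0 => 2%:R
  | 1 => 1
  | (m2.+1 as m1).+1 => s_poly K m1 + 'X * s_poly K m2
  end.

(* Main.v *)
Require Import Defs.
From mathcomp Require Import all_boot all_order all_algebra.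
From mathcomp Require Import reals complex.
From mathcomp Require Import ring.

(** With [a = dn + mu] and [b = - mu] one has [a + b = dn] and
    [a * b = - gamma * dn ^ 2], so the power sums [a ^ m + b ^ m] obey the
    recurrence of [s_m], rescaled by [dn ^ m]; for odd [m] the power sum is
    [(dn + mu) ^ m - mu ^ m].  The degree of [s_(2j+1)] is exactly [j] because
    its coefficient of order [j] is [2j + 1]. *)

Set Implicit Arguments.
Unset Strict Implicit.
Unset Printing Implicit Defensive.

Import Order.TTheory GRing.Theory Num.Theory.
Local Open Scope ring_scope.
Local Open Scope complex_scope.

Lemma s_polySS (K : nzRingType) (m : nat) :
  s_poly K m.+2 = s_poly K m.+1 + 'X * s_poly K m.
Proof. by []. Qed.

(** Both parities go through one induction, since each step of the recurrence mixes them. The even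
    top coefficient stays 2, so the odd one grows by 2 at each step. *)
Lemma s_poly_size_coef (K : nzRingType) (j : nat) :
  [/\ (size (s_poly K j.*2) <= j.+1)%N, (size (s_poly K j.*2.+1) <= j.+1)%N,
      (s_poly K j.*2)`_j = 2%:R & (s_poly K j.*2.+1)`_j = j.*2.+1%:R].
Proof.
have sizeXM (p : {poly K}) n : (size p <= n -> size ('X * p)%R <= n.+1)%N.
  by move=> le_p_n; rewrite -commr_polyX (leq_trans (size_polyMleq _ _)) //
    size_polyX addn2.
elim: j => [|j [size_e size_o coef_e coef_o]].
  by rewrite /= -!polyC_natr; split; rewrite ?size_polyC_leq1 ?coefC.
rewrite doubleS.
have size_e' : (size (s_poly K j.*2.+2) <= j.+2)%N.
  by rewrite s_polySS (leq_trans (size_polyD _ _)) // geq_max leqW //= sizeXM.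
have coef_e' : (s_poly K j.*2.+2)`_j.+1 = 2%:R.
  (* By [size_o], only the ['X] term reaches order [j.+1]. *)
  by rewrite s_polySS coefD coefXM /= coef_e nth_default ?add0r.
split => //; rewrite s_polySS.
  by rewrite (leq_trans (size_polyD _ _)) // geq_max size_e' sizeXM.
by rewrite coefD coefXM coef_e' /= coef_o -natrD.
Qed.

(** Characteristic zero keeps [2j + 1] nonzero, so the size bound is attained. *)
Lemma size_s_poly_odd (K : numDomainType) (j : nat) :
  size (s_poly K j.*2.+1) = j.+1.
Proof.
have [_ size_o _ coef_o] := s_poly_size_coef K j.
apply/eqP; rewrite eqn_leq size_o ltnNge; apply/negP => /leq_sizeP/(_ j).
by rewrite leqnn coef_o => /(_ isT)/eqP; rewrite pnatr_eq0.
Qed.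

Lemma power_sum_s_poly (K : comNzRingType) (a b g : K) (m : nat) :
  a * b = - (g * (a + b) ^+ 2) ->
  a ^+ m + b ^+ m = (a + b) ^+ m * (s_poly K m).[g].
Proof.
move=> ab; suff [] : a ^+ m + b ^+ m = (a + b) ^+ m * (s_poly K m).[g] /\
  a ^+ m.+1 + b ^+ m.+1 = (a + b) ^+ m.+1 * (s_poly K m.+1).[g] by [].
elim: m => [|m [IH0 IH1]].
  by rewrite /= -polyC_natr !hornerE.
split=> //; rewrite s_polySS hornerD -commr_polyX hornerMX.
(* Newton's identity for two variables; the hypothesis turns [- a * b] into [g * (a + b) ^+ 2]. *)
have -> : a ^+ m.+2 + b ^+ m.+2 =
    (a + b) * (a ^+ m.+1 + b ^+ m.+1) - a * b * (a ^+ m + b ^+ m).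
  by rewrite !exprS; ring.
by rewrite ab IH0 IH1 !exprS; ring.
Qed.

Theorem theorem1 (R : realType) (N : nat) (eta : 'I_N.+1 -> R[i])
    (Hdeg : size (odd_polynomial eta) = (2 * N + 1).+1)
    (dn : nat) (Hdn : (0 < dn)%N) (mu : R) :
  let Omega := odd_polynomial eta in
  let gamma : R := mu * (dn%:R + mu) / dn%:R ^+ 2 in
  (forall j : 'I_N.+1, size (s_poly R (2 * j + 1)) = j.+1) /\
  Omega.[(dn%:R + mu)%:C] - Omega.[mu%:C] =
    \sum_(j < N.+1)
      eta j * dn%:R ^+ (2 * j + 1) * ((s_poly R (2 * j + 1)).[gamma])%:C.
Proof.
move=> Omega gamma; split=> [j|].
  by rewrite addn1 mul2n size_s_poly_odd.
rewrite /Omega /odd_polynomial !horner_sum -sumrB; apply: eq_bigr => j _.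
rewrite !hornerZ !hornerXn -mulrBr -mulrA; congr (_ * _).
have dn0 : dn%:R != 0 :> R by rewrite pnatr_eq0 -lt0n.
have := @power_sum_s_poly R (dn%:R + mu) (- mu) gamma (2 * j + 1).
rewrite addrK exprNn -signr_odd oddD oddM /= expr1 mulN1r => pow_sum.
(* The identity holds over [R] and is carried to [R[i]] by the embedding. *)
rewrite -!(rmorphXn (real_complex R)) -rmorphB pow_sum.
  by rewrite rmorphM (rmorphXn (real_complex R)) rmorph_nat.
(* What remains is the condition on [a * b], where [dn0] clears the denominator of [gamma]. *)
by rewrite /gamma divfK ?expf_neq0 // mulrN mulrC.
Qed.
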